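(* Let $K\ge1$ and let $\pi_1\le\pi_2\le\dots\le\pi_K$ be class probabilities, i.e. $\pi_i\ge0$ and $\sum_{i=1}^K\pi_i=1$. Let $M\in\mathbb R$ and let $g_1,\dots,g_K$ be independent samples from the truncated Gumbel distribution $\mathcal{TG}(0,1,M)$. Put $\pi_0=0$. Then for every $1\le n\le K$, $$P\Big(\operatorname*{argmax}_{1\le i\le K}(\log\pi_i+g_i)=n\Big)=\pi_n\sum_{i=1}^{n}\beta(i),$$ where, for $1\le i\le K$, $$\beta(i)=\frac{\exp\!\Big(\big(K+1-i-\tfrac{\sum_{k=i}^K\pi_k}{\pi_i}\big)e^{-M}\Big)-\exp\!\Big(\big(K+1-i-\tfrac{\sum_{k=i}^K\pi_k}{\pi_{i-1}}\big)e^{-M}\Big)}{\sum_{k=i}^K\pi_k}\ \ge\ 0 .$$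
   Context: The standard Gumbel distribution $\mathcal G(0,1)$ has cumulative distribution function $F(x)=e^{-e^{-x}}$, $x\in\mathbb R$. The (right-)truncated Gumbel distribution $\mathcal{TG}(0,1,M)$ is the law of $g\sim\mathcal G(0,1)$ conditioned on $g\le M$. Conventions for zero probabilities (in particular for $\pi_0=0$): $\log 0=-\infty$, $c/0=+\infty$ for $c>0$, and $e^{-\infty}=0$. *)

(* Defs.v *)
From HB Require Import structures.
From mathcomp Require Import all_boot all_order all_algebra finmap.
From mathcomp Require Import all_classical all_reals all_analysis.

Set Implicit Arguments.
Unset Strict Implicit.
Unset Printing Implicit Defensive.

Import Order.TTheory GRing.Theory Num.Theory.
Import numFieldTopology.Exports numFieldNormedType.Exports.

Local Open Scope classical_set_scope.
Local Open Scope ring_scope.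

Definition gumbel_cdf {R : realType} (x : R) : R := expR (- expR (- x)).

Section gumbel_cdf_cumulative.
Context {R : realType}.

Let gumbel_cdf_nd : nondecreasing (@gumbel_cdf R).
Proof. by move=> x y xy; rewrite /gumbel_cdf !(ler_expR, lerN2). Qed.

Let gumbel_cdf_continuous : continuous (@gumbel_cdf R).
Proof.
move=> x; rewrite /gumbel_cdf.
apply: continuous_comp; last exact: continuous_expR.
apply: continuousN; apply: continuous_comp; last exact: continuous_expR.
exact: continuousN.
Qed.

HB.instance Definition _ := isCumulative.Build R _ R gumbel_cdf
  gumbel_cdf_nd (right_continuousW gumbel_cdf_continuous).

Let gumbel_cdfNy : (@gumbel_cdf R) @ -oo --> (0 : R).
Proof.
rewrite /gumbel_cdf; apply/cvgNy_compNP.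
have -> : (fun x : R => expR (- expR (- x))) \o -%R =
    (fun y => expR (- y)) \o expR by apply/funext => x /=; rewrite opprK.
apply: (@cvg_comp _ _ _ expR (fun y => expR (- y)) +oo +oo); last exact: cvgr_expR.
apply/cvgryPge => A; near=> x; apply: le_trans (expR_ge1Dx x).
by rewrite -lerBlDl; near: x; apply: nbhs_pinfty_ge; rewrite num_real.
Unshelve. all: by end_near. Qed.

Let gumbel_cdfy : (@gumbel_cdf R) @ +oo --> (1 : R).
Proof.
rewrite -[X in _ --> X]expR0 -[X in expR X]oppr0.
apply: (@cvg_comp _ _ _ (fun x : R => expR (- x)) (fun y => expR (- y))
  +oo (nbhs (0 : R))); first exact: cvgr_expR.
by apply: continuous_comp; [exact: continuousN|exact: continuous_expR].
Qed.

HB.instance Definition _ :=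
  isCumulativeBounded.Build R 0 1 gumbel_cdf gumbel_cdfNy gumbel_cdfy.

End gumbel_cdf_cumulative.

Definition gumbel (R : realType) : probability (measurableTypeR R) R :=
  lebesgue_stieltjes_measure (@gumbel_cdf R).

Local Open Scope ereal_scope.

(* [cond_law mu B A] is mu(A | B); it is only meaningful when mu B != 0. *)
Definition cond_law d (T : measurableType d) (R : realType)
    (mu : probability T R) (B A : set T) : \bar R :=
  mu (A `&` B) / mu B.

Definition truncated_gumbel (R : realType) (M : R) (A : set R) : \bar R :=
  cond_law (gumbel R) [set x : R | (x <= M)%R] A.

Lemma gumbel_itvNy (R : realType) (x : R) :
  gumbel R [set y : R | (y <= x)%R] = (gumbel_cdf x)%:E.
Proof.
rewrite -(cdf_lebesgue_stieltjes_id (@gumbel_cdf R) x).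
by congr (gumbel R _); apply/seteqP; split => y /=; rewrite in_itv.
Qed.

Lemma truncated_gumbel_itvNy (R : realType) (M x : R) :
  truncated_gumbel M [set y : R | (y <= x)%R] =
  (gumbel_cdf (Num.min x M) / gumbel_cdf M)%:E.
Proof.
rewrite /truncated_gumbel /cond_law gumbel_itvNy.
have -> : [set y : R | (y <= x)%R] `&` [set y | (y <= M)%R] =
    [set y | (y <= Num.min x M)%R].
  by apply/seteqP; split => y /=; rewrite le_min => /andP.
by rewrite gumbel_itvNy inver gt_eqF ?expR_gt0.
Qed.

Definition mutually_independent d (T : measurableType d) (R : realType)
    (P : probability T R) (I : choiceType) (D : set I) (X : I -> {RV P >-> R})
    : Prop :=
  forall (J : {fset I}) (A : I -> set R), [set` J] `<=` D ->
    (forall i, i \in J -> measurable (A i)) ->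
    P (\bigcap_(i in [set` J]) (X i @^-1` A i)) =
    \prod_(i <- J) P (X i @^-1` A i).

(* The set of all maximizers; "argmax = n" is stated as argmax = [set n], i.e.
   n is the unique maximizer. *)
Definition argmax (R : realType) (I : Type) (D : set I) (f : I -> \bar R)
    : set I :=
  [set i | D i /\ forall j, D j -> f j <= f i].

(* The library's [inve] and [expeR] satisfy [0^-1 = +oo] and [expeR -oo = 0],
   which are the conventions needed when p i or p i.-1 vanishes. *)
Definition beta_coef (R : realType) (K : nat) (p : nat -> R) (M : R) (i : nat)
    : \bar R :=
  let S : \bar R := (\sum_(i <= k < K.+1) p k)%R%:E in
  let e q := expeR (((K%:R + 1 - i%:R)%R%:E - S / q%:E) * (expR (- M))%:E) in
  (e (p i) - e (p i.-1)) / S.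

(* Main.v *)
Require Import Defs.
From mathcomp Require Import all_boot all_order all_algebra finmap.
From mathcomp Require Import all_classical all_reals all_analysis.
From mathcomp Require Import ring lra.

Set Implicit Arguments.
Unset Strict Implicit.
Unset Printing Implicit Defensive.

Import Order.TTheory GRing.Theory Num.Theory.
Import numFieldTopology.Exports numFieldNormedType.Exports.

Local Open Scope classical_set_scope.
Local Open Scope ring_scope.

(* Put Y_i = exp (- g_i), which is an exponential variable shifted by
   a = exp (- M), so that the argmax of log p_i + g_i is the argmin of Y_i / p_i.
   Let H t be the probability that n wins with Y_n / p_n < t.  Independence
   bounds H t - H s by probabilities of rectangles.  For v in
   [a / p_i, a / p_{i-1}] only the classes i, ..., K have a non-constant tail at
   v, so these bounds are lower and upper sums of the integral of
   p_n exp ((K + 1 - i) a - S_i v), where S_i = p_i + ... + p_K.  Two functions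
   whose increments over [s, t] differ by O((t - s)^2) differ by a constant;
   hence H increases by p_n beta(i) on that interval, and the increments
   telescope.  When p_{i-1} = 0 the interval is unbounded and the
   value at its right end is the limit of H at infinity. *)

(** * Real analysis: comparing increments, and exponential estimates *)

Lemma le0_archimedean (R : realType) (x L : R) :
  (forall N : nat, x * N.+1%:R <= L) -> x <= 0.
Proof.
move=> xL; rewrite leNgt; apply/negP => x0.
have L0 : 0 <= L by apply: le_trans (xL 0%N); rewrite mulr1 ltW.
have := archi_boundP (divr_ge0 L0 (ltW x0)); rewrite ltr_pdivrMr // => Lb.
have := le_trans (xL (Num.bound (L / x))) (ltW Lb).
by rewrite mulrC ler_pM2r // ler_nat ltnn.
Qed.

(** Cutting [[x, y]] into [N + 1] equal pieces bounds the total increment by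
    [L * (y - x) ^+ 2 / (N + 1)], and [N] is arbitrary. *)
Lemma quadratic_increments_cst (R : realType) (D : R -> R) (x y L : R) :
  x <= y ->
  (forall s t, x <= s -> s <= t -> t <= y -> `|D t - D s| <= L * (t - s) ^+ 2) ->
  D y = D x.
Proof.
move=> xy DL; apply/eqP; rewrite -subr_eq0 -normr_le0.
apply: (@le0_archimedean _ _ (L * (y - x) ^+ 2)) => N.
set h := (y - x) / N.+1%:R.
have h0 : 0 <= h by rewrite divr_ge0 ?subr_ge0.
have hN : h * N.+1%:R = y - x by rewrite divfK ?pnatr_eq0.
have step k : (k <= N.+1)%N -> `|D (x + h *+ k) - D x| <= (L * h ^+ 2) *+ k.
  elim: k => [_|k IH kN]; first by rewrite !mulr0n addr0 subrr normr0.
  rewrite -(subrKA (D (x + h *+ k))) [leRHS]mulrS.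
  apply: le_trans (ler_normD _ _) _; apply: lerD; last exact/IH/ltnW.
  apply: le_trans (DL _ _ _ _ _) _.
  - by rewrite lerDl mulrn_wge0.
  - by rewrite lerD2l mulrSr lerDl.
  - by rewrite -lerBrDl -hN -[h *+ _]mulr_natr ler_wpM2l ?ler_nat.
  - by rewrite mulrSr addrA (addrC _ h) addrK.
have := step _ (leqnn _); rewrite -[h *+ _]mulr_natr hN subrKC => le.
apply: le_trans (ler_wpM2r (ler0n _ _) le) _.
by clearbody h; rewrite -hN -(mulr_natr (L * _)) exprMn !expr2 !mulrA.
Qed.

(** Follows from [expR x >= 1 + x] and [(1 + x) * (1 - x + x ^+ 2) = 1 + x ^+ 3 >= 1]. *)
Lemma expRN_le (R : realType) (x : R) : 0 <= x -> expR (- x) <= 1 - x + x ^+ 2.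
Proof.
move=> x0; rewrite expRN; have := expR_ge1Dx x => x1.
apply: (@le_trans _ _ (1 + x)^-1); first by rewrite lef_pV2 // posrE; nra.
rewrite -[(1 + x)^-1]mul1r ler_pdivrMr; last by nra.
have : 0 <= x ^+ 3 by rewrite exprn_ge0.
nra.
Qed.

(* [H] is squeezed between lower and upper Riemann-Stieltjes terms of the
   integral of [c * r * expR (- (r + m) * v)]. *)
Lemma exp_sandwich (R : realType) (H : R -> R) (x y c r m : R) :
  0 <= c -> 0 < r -> 0 <= m -> x <= y ->
  (forall s t, x <= s -> s <= t -> t <= y ->
    c * ((expR (- (r * s)) - expR (- (r * t))) * expR (- (m * t))) <= H t - H s
    <= c * ((expR (- (r * s)) - expR (- (r * t))) * expR (- (m * s)))) ->
  H y - H x = c * r / (r + m) * (expR (- ((r + m) * x)) - expR (- ((r + m) * y))).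
Proof.
move=> c0 r0 m0 xy Hst; have [S SE] : exists S, S = r + m by exists (r + m).
have S0 : 0 < S by lra.
have mE : m = S - r by lra.
rewrite -SE; have -> : c * r / S = c * (r / S) by rewrite mulrA.
have kS : r / S * S = r by rewrite divfK ?gt_eqF.
have k0 : 0 <= r / S by rewrite divr_ge0 // ltW.
move: (r / S) kS k0 => k kS k0.
(* [D] is [H] minus the expected primitive; since [k * S = r], the first-order terms of its
   increments cancel. *)
pose D t := H t + c * k * expR (- (S * t)).
suff /eqP : D y = D x by rewrite /D => /eqP; lra.
(* With [u = t - s], the estimates [1 - z <= expR (- z) <= 1 - z + z ^+ 2] leave an error of
   [S ^+ 2 * u ^+ 2] below and [r * S * u ^+ 2] above, each times [c * expR (- (S * s))], which is
   largest at [s = x]. The constant adds the two errors. *)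
apply: (@quadratic_increments_cst _ _ _ _
  (c * expR (- (S * x)) * (S ^+ 2 + r * S))) => //.
move=> s t xs st ty; have /andP[] := Hst s t xs st ty.
have [u u0 tE] : exists2 u, 0 <= u & t = s + u by exists (t - s); [lra | ring].
rewrite {}tE in st ty *; have -> : s + u - s = u by ring.
have e_split z : expR (- (z * (s + u))) = expR (- (z * s)) * expR (- (z * u)).
  by rewrite -expRD; congr expR; ring.
have eE : expR (- (r * s)) * expR (- (m * s)) = expR (- (S * s)).
  by rewrite -expRD SE; congr expR; ring.
have fE : expR (- (r * u)) * expR (- (m * u)) = expR (- (S * u)).
  by rewrite -expRD SE; congr expR; ring.
rewrite /D !e_split.
have a1 : 1 - r * u <= expR (- (r * u)) by exact: expR_ge1Dx.
have b1 : 1 - m * u <= expR (- (m * u)) by exact: expR_ge1Dx.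
have f1 : 1 - S * u <= expR (- (S * u)) by exact: expR_ge1Dx.
have f2 : expR (- (S * u)) <= 1 - S * u + (S * u) ^+ 2 by apply: expRN_le; nra.
have ce0 : 0 <= c * expR (- (S * s)) by rewrite mulr_ge0 // expR_ge0.
have cee : c * expR (- (S * s)) <= c * expR (- (S * x)).
  by rewrite ler_wpM2l // ler_expR; nra.
move: (expR (- (r * s))) (expR (- (m * s))) (expR (- (S * s)))
  (expR (- (S * x))) (expR (- (r * u))) (expR (- (m * u))) (expR (- (S * u)))
  eE fE a1 b1 f1 f2 ce0 cee => A B e e' a b f eE fE a1 b1 f1 f2 ce0 cee.
have -> : c * ((A - A * a) * (B * b)) = c * e * (b - f) by rewrite -eE -fE; ring.
have -> : c * ((A - A * a) * B) = c * e * (1 - a) by rewrite -eE; ring.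
have -> : H (s + u) + c * k * (e * f) - (H s + c * k * e) =
  H (s + u) - H s + c * e * k * (f - 1) by ring.
move: (H (s + u) - H s) => dH lo up.
apply: (@le_trans _ _ (c * e * (S ^+ 2 + r * S) * u ^+ 2)); last first.
  rewrite ler_wpM2r ?sqr_ge0 // ler_wpM2r //; nra.
have lo1 := ler_wpM2l ce0 (lerB b1 f2).
have lo2 := ler_wpM2l (mulr_ge0 ce0 k0) f1.
have up1 := ler_wpM2l ce0 (lerB (lexx 1) a1).
have up2 := ler_wpM2l (mulr_ge0 ce0 k0) f2.
have qS0 : 0 <= c * e * (S ^+ 2) * u ^+ 2.
  by rewrite (mulr_ge0 (mulr_ge0 ce0 _)) ?sqr_ge0.
have qr0 : 0 <= c * e * (r * S) * u ^+ 2.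
  by rewrite (mulr_ge0 (mulr_ge0 ce0 _)) ?sqr_ge0 // mulr_ge0 // ltW.
rewrite mE in lo1 lo2; rewrite -kS in lo1 lo2 up1 up2 qS0 qr0 *.
rewrite ler_norml; apply/andP; split; lra.
Qed.
(** For positive [x], the bound [expR (r * t) >= 1 + r * t] makes [x * expR (r * t)] exceed [A] as
    soon as [t >= A / (x * r)] and [t >= 0]. *)
Lemma exp_decay_le0 (R : realType) (x A r b : R) : 0 < r ->
  (forall t, b <= t -> x <= A * expR (- (r * t))) -> x <= 0.
Proof.
move=> r0 xA; rewrite leNgt; apply/negP => x0.
pose t := Num.max (Num.max b 0) (A / (x * r)).
have bt : b <= t by rewrite /t !le_max lexx.
have t0 : 0 <= t by rewrite /t !le_max lexx orbT.
have At : A <= t * (x * r).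
  by rewrite -ler_pdivrMr ?mulr_gt0 // /t le_max lexx orbT.
have := xA t bt; rewrite leNgt => /negP; apply.
rewrite expRN -/(_ / _) ltr_pdivrMr ?expR_gt0 //.
have := expR_ge1Dx (r * t); nra.
Qed.

(** Replacing one factor of a product of exponentials multiplies it by [x / expR (F n)]. Here the
    replaced factor will be that of the winning class. *)
Lemma prod_replace_expR (R : realType) (F : nat -> R) (x : R) (i n k : nat) :
  (i <= n < k)%N ->
  \prod_(i <= j < k) (if j == n then x else expR (F j)) =
  x * expR (\sum_(i <= j < k) F j - F n).
Proof.
move=> ink; rewrite expRD expR_sum expRN.
under eq_bigr => j _.
  rewrite (_ : (if _ then _ else _) =
    expR (F j) * (if j == n then x / expR (F n) else 1)); last first.
    by case: eqP => [->|_]; rewrite ?mulr1 // mulrC divfK // gt_eqF // expR_gt0.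
  over.
rewrite big_split -big_mkcond big_nat1_eq ink /=; ring.
Qed.

(** * Measurability of comparison events *)

Section measurable_comparison.
Context (R : realType) (d : measure_display) (T : measurableType d).
Variables f g : T -> R.
Hypotheses (mf : measurable_fun setT f) (mg : measurable_fun setT g).

Lemma measurable_set_ler : measurable [set x | f x <= g x].
Proof.
have mfg := measurable_realfun.measurable_fun_ler mf mg.
by rewrite -[X in measurable X]setTI; apply: (mfg measurableT [set true]).
Qed.

Lemma measurable_set_ltr : measurable [set x | f x < g x].
Proof.
have mfg := measurable_realfun.measurable_fun_ltr mf mg.
by rewrite -[X in measurable X]setTI; apply: (mfg measurableT [set true]).
Qed.

End measurable_comparison.

Lemma measurable_expRN (R : realType) (d : measure_display)
    (T : measurableType d) (f : T -> R) :
  measurable_fun setT f -> measurable_fun setT (fun x => expR (- f x)).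
Proof.
move=> mf; apply: measurableT_comp; first exact: measurable_realfun.measurable_expR.
exact: measurableT_comp.
Qed.

(** * Real-valued probabilities, independence, and the tail of [expR (- X)] *)

Section probability_lemmas.
Context (R : realType) (d : measure_display) (T : measurableType d).
Variable P : probability T R.

Lemma probability_fineE A : measurable A -> P A = (fine (P A))%:E.
Proof. by move=> mA; rewrite fineK // fin_num_measure. Qed.

Lemma fine_probabilityDI A B : measurable A -> measurable B ->
  fine (P A) = fine (P (A `\` B)) + fine (P (A `&` B)).
Proof.
move=> mA mB; apply: EFin_inj; rewrite EFinD.
have mD := measurableD mA mB; have mI := measurableI _ _ mA mB.
by rewrite -!probability_fineE //; exact: measureDI.
Qed.

Lemma le_fine_probability A B : measurable A -> measurable B -> A `<=` B ->
  fine (P A) <= fine (P B).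
Proof.
move=> mA mB AB; rewrite -lee_fin -!probability_fineE //.
by apply: le_measure => //; rewrite inE.
Qed.

Lemma mutually_independent_prod (K : nat) (X : nat -> {RV P >-> R})
    (A : nat -> set R) :
  mutually_independent [set i | (1 <= i <= K)%N] X ->
  (forall i, measurable (A i)) ->
  P (\bigcap_(i in [set i | (1 <= i <= K)%N]) (X i @^-1` A i)) =
  (\prod_(1 <= i < K.+1) P (X i @^-1` A i))%E.
Proof.
move=> indep mA; pose J := [fset i in index_iota 1 K.+1]%fset.
have JE : [set` J] = [set i | (1 <= i <= K)%N].
  by apply/seteqP; split => i /=; rewrite !inE mem_index_iota ltnS.
rewrite -JE indep //; last by rewrite JE.
apply: perm_big; apply: uniq_perm; rewrite ?fset_uniq ?iota_uniq // => i.
by rewrite !inE.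
Qed.

(** For [c > 0] the event is [X <= - ln c], where the truncated cdf is a quotient of two double
    exponentials. For [c <= 0] the event is sure and the maximum is [expR (- M)]. *)
Lemma truncated_gumbel_tail (M c : R) (X : {RV P >-> R}) :
  (forall A : set R, measurable A -> distribution P X A = truncated_gumbel M A) ->
  P (X @^-1` [set x | c <= expR (- x)]) =
  (expR (expR (- M) - Num.max c (expR (- M))))%:E.
Proof.
move=> lawX; have mc : measurable [set x : R | c <= expR (- x)].
  by apply: measurable_set_ler => //; exact: measurable_expRN.
have PXE A : P (X @^-1` A) = distribution P X A by [].
rewrite PXE; have [c0|c0] := leP c 0.
  have -> : [set x : R | c <= expR (- x)] = setT.
    by apply/seteqP; split => x //= _; apply: le_trans c0 (expR_ge0 _).
  rewrite probability_setT max_r ?subrr ?expR0 //.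
  exact: le_trans c0 (expR_ge0 _).
rewrite lawX //.
have cE x : (c <= expR (- x)) = (x <= - ln c).
  by rewrite lerNr -[RHS]ler_expR lnK.
have -> : [set x : R | c <= expR (- x)] = [set x | x <= - ln c].
  by apply/seteqP; split => x /=; rewrite cE.
rewrite truncated_gumbel_itvNy /gumbel_cdf; congr (_%:E).
rewrite -expRN -expRD opprK addrC; congr expR; congr (_ - _).
have [cM|cM] := leP (- ln c) M.
  rewrite opprK lnK ?posrE // max_l //.
  by rewrite -[leRHS](@lnK _ c) ?posrE // ler_expR lerNl.
by rewrite max_r // -[leLHS](@lnK _ c) ?posrE // ler_expR lerNr ltW.
Qed.

End probability_lemmas.

(** * The coefficients beta(i) as real numbers *)

(* The case q = 0 is the convention exp (- S / 0) = 0; in R, S / 0 would be 0. *)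
Definition beta_term (R : realType) (K : nat) (p : nat -> R) (M : R) (i : nat)
    (q : R) : R :=
  if q == 0 then 0
  else expR ((K%:R + 1 - i%:R - (\sum_(i <= k < K.+1) p k) / q) * expR (- M)).

(** Positivity of the sum is what makes its quotient by 0 equal to [+oo], so that the exponential
    vanishes as in [beta_term]. *)
Lemma beta_coefE (R : realType) (K : nat) (p : nat -> R) (M : R) (i : nat) :
  0 < \sum_(i <= k < K.+1) p k ->
  beta_coef K p M i =
  ((beta_term K p M i (p i) - beta_term K p M i (p i.-1)) /
   \sum_(i <= k < K.+1) p k)%:E.
Proof.
move=> S0; rewrite /beta_coef /beta_term.
have termE q : expeR (((K%:R + 1 - i%:R)%R%:E -
      (\sum_(i <= k < K.+1) p k)%R%:E / q%:E) * (expR (- M))%:E) =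
    (if q == 0 then 0 else
     expR ((K%:R + 1 - i%:R - (\sum_(i <= k < K.+1) p k) / q) * expR (- M)))%:E.
  rewrite inver; case: eqP => // _.
  by rewrite gt0_muley ?lte_fin // addeNy gt0_mulNye ?lte_fin ?expR_gt0.
by rewrite !termE -EFinB inver (gt_eqF S0).
Qed.

(** Applied to [p i.-1 <= p i], this gives the nonnegativity of beta(i). *)
Lemma le_beta_term (R : realType) (K : nat) (p : nat -> R) (M : R) (i : nat)
    (q r : R) :
  0 <= \sum_(i <= k < K.+1) p k -> 0 <= q -> q <= r ->
  beta_term K p M i q <= beta_term K p M i r.
Proof.
move=> S0 q0 qr; rewrite /beta_term.
have [_|/eqP qn0] := eqP; first by case: ifP => _ //; exact: expR_ge0.
have qgt0 : 0 < q by rewrite lt_def qn0.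
have rgt0 := lt_le_trans qgt0 qr; rewrite gt_eqF // ler_expR.
by rewrite ler_pM2r ?expR_gt0 // lerB // ler_wpM2l // lef_pV2.
Qed.

(** * The race between the variables [Y i / p i] *)

Section race.
Context (R : realType) (d : measure_display) (T : measurableType d).
Variables (P : probability T R) (K : nat) (p : nat -> R) (M : R).
Variable g : nat -> {RV P >-> R}.
Hypothesis p0 : p 0%N = 0.
Hypothesis p_ge0 : forall i, (1 <= i <= K)%N -> 0 <= p i.
Hypothesis p_nd :
  forall i j, (1 <= i)%N -> (i <= j)%N -> (j <= K)%N -> p i <= p j.
Hypothesis g_law : forall i, (1 <= i <= K)%N -> forall A : set R,
  measurable A -> distribution P (g i) A = truncated_gumbel M A.
Hypothesis g_indep : mutually_independent [set i | (1 <= i <= K)%N] g.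

Let a := expR (- M).
Let Y i w := expR (- g i w).

Let p_pred_ge0 i : (1 <= i <= K)%N -> 0 <= p i.-1.
Proof.
case: i => [//|[|i]] /andP[_ iK]; first by rewrite p0.
by rewrite p_ge0 //= ltnW.
Qed.

Let p_pred_le i : (1 <= i <= K)%N -> p i.-1 <= p i.
Proof.
case: i => [//|[|i]] iK; first by rewrite p0 p_ge0.
by rewrite p_nd //=; case/andP: iK.
Qed.

Let measurable_Y i : measurable_fun setT (Y i).
Proof. exact: measurable_expRN. Qed.

Let measurable_mulY x i : measurable_fun setT (fun w => x * Y i w).
Proof. exact: measurable_realfun.measurable_funM. Qed.

Variable n : nat.
Hypothesis nK : (1 <= n <= K)%N.
Hypothesis pn_gt0 : 0 < p n.

(* Y n / p n < Y j / p j for all j <> n, multiplied out to allow p j = 0. *)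
Definition race_win : set T :=
  \bigcap_(j in [set j | (1 <= j <= K)%N && (j != n)])
    [set w | p j * Y n w < p n * Y j w].

Definition race_win_before t : set T :=
  race_win `&` [set w | Y n w < p n * t].

(** The probability that [Y i >= c], common to all classes; it is 1 for [c <= a]. *)
Let tail c := expR (a - Num.max c a).

(** Sides of a rectangle: the time [Y n / p n] lies in [[s, t)] and every rival's time is at least
    [u]. The choices [u = t] and [u = s] give the inner and outer rectangles. *)
Let slab s t u (j : nat) : set R :=
  if j == n then [set x | p n * s <= expR (- x) < p n * t]
  else [set x | p j * u <= expR (- x)].

Lemma measurable_race_win : measurable race_win.
Proof.
by apply: bigcap_measurableType => j _; exact: measurable_set_ltr.
Qed.

Lemma measurable_race_win_before t : measurable (race_win_before t).
Proof.
by apply: measurableI; [exact: measurable_race_win | exact: measurable_set_ltr].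
Qed.

Let tailE i c : (1 <= i <= K)%N ->
  P (g i @^-1` [set x | c <= expR (- x)]) = (tail c)%:E.
Proof. by move=> iK; exact/truncated_gumbel_tail/g_law. Qed.

Let measurable_slab s t u j : measurable (slab s t u j).
Proof.
have me := @measurable_expRN R _ _ (@idfun R) (@measurable_id _ _ _).
rewrite /slab; case: eqP => _; last by apply: measurable_set_ler.
rewrite (_ : mkset _ = [set x | p n * s <= expR (- x)] `&`
                      [set x | expR (- x) < p n * t]).
  by apply: measurableI; [exact: measurable_set_ler | exact: measurable_set_ltr].
by apply/seteqP; split => x /= => [/andP | [-> ->]].
Qed.

(** Independence gives a product; the winner's interval is a difference of two half-lines, hence its
    factor is a difference of tails. *)
Let probability_slab s t u : s <= t ->
  fine (P (\bigcap_(j in [set j | (1 <= j <= K)%N]) (g j @^-1` slab s t u j))) =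
  \prod_(1 <= j < K.+1)
    (if j == n then tail (p n * s) - tail (p n * t) else tail (p j * u)).
Proof.
move=> st; apply: EFin_inj; rewrite -probability_fineE; last first.
  apply: bigcap_measurableType => j _; rewrite -[X in measurable X]setTI.
  exact: measurable_funPT.
rewrite mutually_independent_prod // -prodEFin.
apply: eq_big_nat => j jK; rewrite /slab; case: eqP => [->|_]; last first.
  exact: tailE.
have mge c : measurable [set w | c <= Y n w] by apply: measurable_set_ler.
have := fine_probabilityDI P (mge (p n * s)) (mge (p n * t)).
rewrite (_ : _ `&` _ = [set w | p n * t <= Y n w]); last first.
  apply/seteqP; split => w /= => [[]//|ptw]; split => //.
  by apply: le_trans ptw; rewrite ler_pM2l.
rewrite (_ : _ `\` _ = g n @^-1` [set x | p n * s <= expR (- x) < p n * t]).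
  have tE c : fine (P [set w | c <= Y n w]) = tail c.
    by apply: EFin_inj; rewrite -probability_fineE //; exact: tailE.
  rewrite !tE => ->; rewrite addrK -probability_fineE //.
  rewrite -[X in measurable X]setTI; apply: measurable_funPT => //.
  by have := measurable_slab s t 0 n; rewrite /slab eqxx.
apply/seteqP; split => w /= => [[-> /negP]|/andP[-> ?]]; first by rewrite -ltNge.
by split => //; apply/negP; rewrite -ltNge.
Qed.

Lemma race_win_before_increment s t : s <= t ->
  fine (P (race_win_before t)) - fine (P (race_win_before s)) =
  fine (P (race_win `&` [set w | p n * s <= Y n w < p n * t])).
Proof.
move=> st.
have := fine_probabilityDI P (measurable_race_win_before t)
  (measurable_race_win_before s).
rewrite (_ : race_win_before t `&` _ = race_win_before s); last first.
  apply/seteqP; split => w /= => [[]//|[Ew Ys]]; split => //; split => //=.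
  by apply: lt_le_trans Ys _; rewrite ler_pM2l.
rewrite (_ : _ `\` _ = race_win `&` [set w | p n * s <= Y n w < p n * t]).
  by move=> ->; rewrite addrK.
apply/seteqP; split => w /=.
  move=> [[Ew Yt] nEs]; split => //; rewrite Yt andbT leNgt.
  by apply/negP => Ys; apply: nEs.
by move=> [Ew /andP[Ys Yt]]; split; [split|move=> [_ /=]; rewrite ltNge Ys].
Qed.

(** When the time of [n] lies in [[s, t)], rivals all at or beyond [t] force a win, and a win forces
    all rivals to be at or beyond [s]. *)
Lemma race_win_before_bounds s t : s <= t ->
  \prod_(1 <= j < K.+1)
    (if j == n then tail (p n * s) - tail (p n * t) else tail (p j * t)) <=
  fine (P (race_win_before t)) - fine (P (race_win_before s)) <=
  \prod_(1 <= j < K.+1)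
    (if j == n then tail (p n * s) - tail (p n * t) else tail (p j * s)).
Proof.
move=> st; rewrite race_win_before_increment // -!probability_slab //.
have mslab u : measurable (\bigcap_(j in [set j | (1 <= j <= K)%N])
    (g j @^-1` slab s t u j)).
  apply: bigcap_measurableType => j _; rewrite -[X in measurable X]setTI.
  exact: measurable_funPT.
have mmid : measurable (race_win `&` [set w | p n * s <= Y n w < p n * t]).
  apply: measurableI; first exact: measurable_race_win.
  rewrite -[X in measurable X]setTI.
  have := measurable_slab s t 0 n; rewrite /slab eqxx => /(measurable_funPT (g n)).
  exact.
apply/andP; split; apply: le_fine_probability => // w.
  move=> slabw; have := slabw n nK; rewrite /slab eqxx /= => Ynw; split => //.
  move=> j /= /andP[jK jn]; have := slabw j jK; rewrite /slab (negbTE jn) /= => Yjw.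
  have [pj0|pj0] := ltP 0 (p j).
    move: Ynw => /andP[_ Ynt].
    apply: (@lt_le_trans _ _ (p j * (p n * t))); first by rewrite ltr_pM2l.
    by rewrite mulrCA ler_pM2l.
  (* A class of probability zero is always beaten: the inequality becomes [0 < p n * Y j w]. *)
  have -> : p j = 0 by apply/le_anti; rewrite pj0 p_ge0.
  by rewrite mul0r mulr_gt0 // expR_gt0.
move=> [win /= Ynw] j /= jK; rewrite /slab; case: eqP => [->//|/eqP jn] /=.
have jw : p j * Y n w < p n * Y j w by apply: win; rewrite /= jK.
rewrite -(ler_pM2l pn_gt0); apply: le_trans (ltW jw).
by rewrite mulrCA ler_wpM2l ?p_ge0 //; case/andP: Ynw.
Qed.

(** Truncation at [M] makes [Y n >= a] almost sure, since [tail a = 1]. *)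
Lemma race_win_before_start t : p n * t <= a -> fine (P (race_win_before t)) = 0.
Proof.
move=> ta; have mge c : measurable [set w | c <= Y n w] by exact: measurable_set_ler.
have := fine_probabilityDI P measurableT (mge a).
rewrite setTI probability_setT (_ : P [set w | a <= Y n w] = (tail a)%:E); last first.
  exact: tailE.
rewrite /tail maxxx subrr expR0 /= => PT.
apply/le_anti; rewrite fine_ge0 // andbT.
have : fine (P (race_win_before t)) <= fine (P (setT `\` [set w | a <= Y n w])).
  apply: le_fine_probability; first exact: measurable_race_win_before.
    exact: measurableD.
  move=> w [_ /= Yt]; split => //; apply/negP; rewrite -ltNge.
  exact: lt_le_trans ta.
lra.
Qed.

(** A win that does not occur before [t] requires [Y n >= p n * t]. This controls the limit at
    infinity. *)
Lemma race_win_after t :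
  0 <= fine (P race_win) - fine (P (race_win_before t)) <= tail (p n * t).
Proof.
have mge c : measurable [set w | c <= Y n w] by exact: measurable_set_ler.
have mlt c : measurable [set w | Y n w < c] by exact: measurable_set_ltr.
rewrite (fine_probabilityDI P measurable_race_win (mlt (p n * t))) addrK.
have -> : tail (p n * t) = fine (P [set w | p n * t <= Y n w]).
  by apply: EFin_inj; rewrite -probability_fineE //; exact/esym/tailE.
rewrite fine_ge0 //=; apply: le_fine_probability => //.
  by apply: measurableD => //; exact: measurable_race_win.
by move=> w [_ /= /negP]; rewrite -leNgt.
Qed.

(** * Evaluation between consecutive thresholds [a / p i], and telescoping *)

Let S i := \sum_(i <= k < K.+1) p k.

Lemma le_tail_sum i : (1 <= i <= n)%N -> p n <= S i.
Proof.
move=> /andP[i1 iN]; have /andP[n1 nleK] := nK.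
rewrite -[leLHS](_ : \sum_(i <= k < K.+1 | k == n) p k = _); last first.
  by rewrite big_nat1_eq iN ltnS nleK.
rewrite big_mkcond; apply: ler_sum_nat => j /andP[ij jK].
by case: eqP => // _; rewrite p_ge0 // (leq_trans i1 ij).
Qed.

(** By monotonicity of [p], classes below [i] have [p j * u <= a] and tail 1, while the [K + 1 - i]
    others have tail [expR (a - p j * u)]. *)
Let prod_tail i s t u : (1 <= i <= n)%N -> a <= p i * s -> a <= p i * t ->
  a <= p i * u -> p i.-1 * u <= a -> 0 <= u ->
  \prod_(1 <= j < K.+1)
    (if j == n then tail (p n * s) - tail (p n * t) else tail (p j * u)) =
  expR ((K%:R + 1 - i%:R) * a) *
  ((expR (- (p n * s)) - expR (- (p n * t))) * expR (- ((S i - p n) * u))).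
Proof.
move=> /andP[i1 iN] ais ait aiu aiu' u0; have /andP[n1 nleK] := nK.
have pi0 : 0 < p i.
  rewrite -(pmulr_lgt0 (x := u)); first by apply: lt_le_trans aiu; exact: expR_gt0.
  rewrite lt_neqAle u0 andbT; apply/eqP => u00; move: aiu.
  by rewrite -u00 mulr0 leNgt expR_gt0.
have tail_act j x : (i <= j <= K)%N -> a <= p i * x -> tail (p j * x) = expR (a - p j * x).
  move=> /andP[ij jK] aix; rewrite /tail max_l //; apply: (le_trans aix).
  have x0 : 0 <= x.
    rewrite -(pmulr_rge0 _ pi0); apply: le_trans aix; exact: expR_ge0.
  by rewrite ler_wpM2r // p_nd.
rewrite (@big_cat_nat _ _ _ i) //=; last by rewrite leqW // (leq_trans iN).
rewrite big1_seq ?mul1r; last first.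
  move=> j /=; rewrite mem_index_iota => /andP[j1 ji].
  rewrite ltn_eqF; last exact: leq_trans ji iN.
  rewrite /tail max_r ?subrr ?expR0 //; apply: le_trans aiu'.
  rewrite ler_wpM2r // p_nd //; first by rewrite -ltnS prednK.
  by rewrite (leq_trans (leq_pred _)) // (leq_trans iN).
rewrite !tail_act ?iN //.
under eq_big_nat => j /andP[ij jK] do rewrite tail_act ?ij //.
rewrite prod_replace_expR ?iN ?ltnS // sumrB sumr_const_nat -mulr_suml -/(S i).
rewrite -[a *+ _]mulr_natl natrB; last by rewrite leqW // (leq_trans iN).
(* The [a] removed with the exponent of class [n] is set apart, to cancel against the factor
   [expR a] of the two tails of [n]. *)
have -> : (K.+1%:R - i%:R) * a - S i * u - (a - p n * u) =
  ((K%:R + 1 - i%:R) * a - (S i - p n) * u) - a by rewrite -natr1; ring.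
rewrite !expRD.
move: (expR ((K%:R + 1 - i%:R) * a)) (expR (- ((S i - p n) * u)))
  (expR (- (p n * s))) (expR (- (p n * t))) => C m x y.
have aE : expR a * expR (- a) = 1 by rewrite -expRD subrr expR0.
transitivity (C * ((x - y) * m) * (expR a * expR (- a))); first by ring.
by rewrite aE mulr1.
Qed.

(** This is [exp_sandwich] on [[a / p i, t]] with [r = p n] and [m = S i - p n], so that
    [r + m = S i]; the two bounds are evaluated by [prod_tail]. *)
Lemma race_win_piece i t : (1 <= i <= n)%N -> 0 < p i -> a <= p i * t ->
  p i.-1 * t <= a ->
  fine (P (race_win_before t)) - fine (P (race_win_before (a / p i))) =
  p n * (expR ((K%:R + 1 - i%:R - S i / p i) * a) -
         expR ((K%:R + 1 - i%:R) * a - S i * t)) / S i.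
Proof.
move=> iN pi0 ait ait'; have /andP[i1 in'] := iN.
have ai : a / p i <= t by rewrite ler_pdivrMr // mulrC.
have m0 : 0 <= S i - p n by rewrite subr_ge0 le_tail_sum.
have pp0 : 0 <= p i.-1.
  by rewrite p_pred_ge0 // i1 (leq_trans in') //; case/andP: nK.
rewrite (@exp_sandwich _ (fun t => fine (P (race_win_before t))) _ _
  (expR ((K%:R + 1 - i%:R) * a)) (p n) (S i - p n)) ?expR_ge0 //; last first.
  move=> s u ais su ut.
  have s0 : 0 <= s.
    by apply: le_trans ais; rewrite divr_ge0 ?expR_ge0 // ltW.
  have pis : a <= p i * s by rewrite mulrC -ler_pdivrMr.
  have piu : a <= p i * u by apply: le_trans pis _; rewrite ler_pM2l.
  have piu' : p i.-1 * u <= a by apply: le_trans ait'; rewrite ler_wpM2l.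
  have pis' : p i.-1 * s <= a by apply: le_trans piu'; rewrite ler_wpM2l.
  rewrite -(prod_tail _ pis piu piu) // ?(le_trans s0) //.
  by rewrite -(prod_tail _ pis piu pis) // race_win_before_bounds.
have -> : p n + (S i - p n) = S i by ring.
transitivity (p n * (expR ((K%:R + 1 - i%:R) * a) * expR (- (S i * (a / p i))) -
    expR ((K%:R + 1 - i%:R) * a) * expR (- (S i * t))) / S i); first by ring.
by rewrite -!expRD; congr (_ * (expR _ - expR _) / _); ring.
Qed.

Let btE i q : 0 < q ->
  beta_term K p M i q = expR ((K%:R + 1 - i%:R) * a - S i * (a / q)).
Proof. by move=> q0; rewrite /beta_term gt_eqF // -/a -/(S i); congr expR; ring. Qed.

(** Here [race_win_piece] holds for every [t >= a / p i]. Its remainder and the probability of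
    winning after [t] both decay exponentially, which gives the two inequalities. *)
Let race_win_last i : (1 <= i <= n)%N -> 0 < p i -> p i.-1 = 0 ->
  fine (P race_win) - fine (P (race_win_before (a / p i))) =
  p n * beta_term K p M i (p i) / S i.
Proof.
move=> iN pi0 pp0; have /andP[i1 in'] := iN; have /andP[n1 nleK] := nK.
have S0 : 0 < S i := lt_le_trans pn_gt0 (le_tail_sum iN).
have piece t : a / p i <= t ->
    fine (P (race_win_before t)) - fine (P (race_win_before (a / p i))) =
    p n * beta_term K p M i (p i) / S i -
    p n * expR ((K%:R + 1 - i%:R) * a) / S i * expR (- (S i * t)).
  move=> at'; rewrite race_win_piece //; last 2 first.
  - by rewrite mulrC -ler_pdivrMr.
  - by rewrite pp0 mul0r expR_ge0.
  rewrite btE // [(_ - S i / p i) * a](_ : _ = (K%:R + 1 - i%:R) * a - S i * (a / p i)).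
    by rewrite !expRD; ring.
  by ring.
apply/eqP; rewrite -subr_eq0; apply/eqP/le_anti/andP; split.
  apply: (@exp_decay_le0 _ _ (expR a) (p n) (a / p i)) => // t at'.
  have /andP[_] := race_win_after t; have := piece t at'.
  have ant : a <= p n * t.
    rewrite mulrC; apply: (@le_trans _ _ (t * p i)); first by rewrite -ler_pdivrMr.
    rewrite ler_wpM2l ?p_nd //.
    by apply: le_trans at'; rewrite divr_ge0 ?expR_ge0 // ltW.
  rewrite /tail max_l // expRD.
  have : 0 <= p n * expR ((K%:R + 1 - i%:R) * a) / S i * expR (- (S i * t)).
    by rewrite !mulr_ge0 ?invr_ge0 ?expR_ge0 // ltW.
  lra.
rewrite -oppr_le0.
apply: (@exp_decay_le0 _ _ (p n * expR ((K%:R + 1 - i%:R) * a) / S i) (S i) (a / p i)) => // t at'.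
have /andP[] := race_win_after t; have := piece t at'; lra.
Qed.

Lemma race_win_probability : fine (P race_win) =
  p n * \sum_(1 <= i < n.+1)
    (beta_term K p M i (p i) - beta_term K p M i (p i.-1)) / S i.
Proof.
(* [G i] is the probability of a win before [a / p i], read as a win at any time when this threshold
   is infinite. As [i] runs from 0 to [n], it goes from the full probability down to 0. *)
pose G i := if p i == 0 then fine (P race_win)
  else fine (P (race_win_before (a / p i))).
have Gn : G n = 0.
  by rewrite /G gt_eqF // race_win_before_start // mulrC divfK ?gt_eqF.
have G0 : G 0%N = fine (P race_win) by rewrite /G p0 eqxx.
have step i : (1 <= i <= n)%N -> G i.-1 - G i =
    p n * ((beta_term K p M i (p i) - beta_term K p M i (p i.-1)) / S i).
  move=> iN; have /andP[i1 in'] := iN; have /andP[n1 nleK] := nK.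
  have iK : (1 <= i <= K)%N by rewrite i1 (leq_trans in').
  have pp0 := p_pred_ge0 iK; have ple := p_pred_le iK.
  rewrite /G; have [pi0|/eqP pin0] := eqVneq (p i) 0.
    (* Both thresholds are infinite and both [beta_term] values are 0, so the identity reads
       [0 = 0]. *)
    have -> : p i.-1 = 0 by apply/le_anti; rewrite pp0 andbT -pi0 ple.
    by rewrite eqxx /beta_term pi0 eqxx !subrr mul0r mulr0.
  have pi0 : 0 < p i by rewrite lt_def p_ge0 // andbT; apply/eqP.
  have [ppi0|/eqP ppn0] := eqVneq (p i.-1) 0.
    by rewrite race_win_last // ppi0 /beta_term eqxx subr0 mulrA.
  have ppi0 : 0 < p i.-1 by rewrite lt_def pp0 andbT; apply/eqP.
  rewrite race_win_piece //.
  - by rewrite (btE _ ppi0) /beta_term (gt_eqF pi0) -/a -/(S i) [RHS]mulrA.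
  - by rewrite mulrCA ler_peMr ?expR_ge0 // ler_pdivlMr // mul1r.
  - by rewrite mulrC divfK ?gt_eqF.
rewrite mulr_sumr big_add1 /=.
rewrite (@telescope_sumr_eq _ _ _ (fun k => - G k)) // => [|k kn].
  by rewrite opprK Gn G0 oppr0 add0r.
by rewrite -step // opprK addrC.
Qed.

End race.

(** * From the argmax to the race *)

Lemma argmax_eq_set1 (R : realType) (I : Type) (D : set I) (f : I -> \bar R)
    (n : I) : D n ->
  argmax D f = [set n] <-> forall j, D j -> j <> n -> (f j < f n)%E.
Proof.
move=> Dn; split=> [fn j Dj jn|fn].
  have [_ nmax] : argmax D f n by rewrite fn.
  rewrite lt_neqAle nmax // andbT; apply/eqP => fjn; apply: jn.
  have : argmax D f j by split => // k Dk; rewrite fjn nmax.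
  by rewrite fn.
apply/seteqP; split => [j [Dj jmax]|_ ->].
  by apply: contrapT => jn; have := fn j Dj jn; rewrite ltNge jmax.
split => // j Dj; have [->//|jn] := pselect (j = n).
exact/ltW/fn.
Qed.

(** Exponentiate and multiply by [expR (- u - v)]. For [x = 0] both comparisons hold, the left one
    because its smaller side is [-oo]. *)
Lemma lt_lneD (R : realType) (x y u v : R) : 0 <= x -> 0 < y ->
  (lne x%:E + u%:E < lne y%:E + v%:E)%E = (x * expR (- v) < y * expR (- u)).
Proof.
move=> x0 y0; rewrite (lne_EFin y0) -EFinD.
have [->|/eqP xn0] := eqVneq x 0.
  by rewrite le0_lneNy // addNye ltNyr mul0r mulr_gt0 // expR_gt0.
have xgt0 : 0 < x by rewrite lt_def x0 andbT; apply/eqP.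
rewrite (lne_EFin xgt0) -EFinD lte_fin.
rewrite -[in RHS](@lnK _ x) ?posrE // -[in RHS](@lnK _ y) ?posrE //.
rewrite -!expRD ltr_expR; apply/idP/idP; lra.
Qed.

(* Classes are indexed by 1, ..., K as natural numbers; the values of p and g
   at indices above K, and g 0, are irrelevant. *)
Theorem proposition5p2 (R : realType) (d : measure_display)
    (T : measurableType d) (P : probability T R)
    (K : nat) (hK : (1 <= K)%N)
    (p : nat -> R)
    (p0 : p 0%N = 0)
    (p_ge0 : forall i, (1 <= i <= K)%N -> 0 <= p i)
    (p_sum1 : \sum_(1 <= i < K.+1) p i = 1)
    (p_nd : forall i j, (1 <= i)%N -> (i <= j)%N -> (j <= K)%N -> p i <= p j)
    (M : R)
    (g : nat -> {RV P >-> R})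
    (g_law : forall i, (1 <= i <= K)%N -> forall A : set R, measurable A ->
       distribution P (g i) A = truncated_gumbel M A)
    (g_indep : mutually_independent [set i | (1 <= i <= K)%N] g) :
  (forall n, (1 <= n <= K)%N ->
     P [set w | argmax [set i | (1 <= i <= K)%N]
                  (fun i => lne (p i)%:E + (g i w)%:E)%E = [set n]] =
     ((p n)%:E * \sum_(1 <= i < n.+1) beta_coef K p M i)%E) /\
  (forall i, (1 <= i <= K)%N -> (0 <= beta_coef K p M i)%E).
Proof.
have S_gt0 i : (1 <= i <= K)%N -> 0 < \sum_(i <= k < K.+1) p k.
  move=> /andP[i1 iK].
  (* [p K] is the largest probability; were it 0, all would vanish and could not sum to 1. *)
  have pK_gt0 : 0 < p K.
    rewrite lt_def p_ge0 ?hK ?leqnn // andbT; apply/eqP => pK0.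
    have := p_sum1; rewrite big_nat big1 => [/esym/eqP|j /andP[j1 jK]].
      by rewrite oner_eq0.
    by apply/le_anti; rewrite p_ge0 ?j1 // andbT -pK0 p_nd.
  rewrite big_nat_recr //= ltr_wpDl // big_nat sumr_ge0 // => j /andP[ij jK].
  by rewrite p_ge0 // (leq_trans i1 ij) ltnW.
have pred_ge0 i : (1 <= i <= K)%N -> 0 <= p i.-1 <= p i.
  case: i => [//|[|i]] iK; first by rewrite p0 lexx p_ge0.
  have /andP[_ iK'] := iK.
  by rewrite p_ge0 ?p_nd //= ltnW.
split=> [n nK|i iK]; last first.
  have /andP[pp0 ppi] := pred_ge0 i iK.
  rewrite beta_coefE ?S_gt0 // lee_fin divr_ge0 ?subr_ge0 ?le_beta_term //;
    exact/ltW/S_gt0.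
(* If [p n = 0], the score of [n] is [-oo], which cannot strictly exceed that of class [K], so the
   event is empty. *)
have -> : [set w | argmax [set i | (1 <= i <= K)%N]
    (fun i => lne (p i)%:E + (g i w)%:E)%E = [set n]] =
    if p n == 0 then set0 else race_win K p g n.
  apply/funext => w; apply/propext; rewrite /mkset; split.
    move/argmax_eq_set1 => /(_ nK) win; case: eqP => [pn0|/eqP pn0].
      have KK : (1 <= K <= K)%N by rewrite hK leqnn.
      have pK_gt0 : 0 < p K by have := S_gt0 K KK; rewrite big_nat1.
      have Kn : K <> n by move=> Kn; move: pK_gt0; rewrite Kn pn0 ltxx.
      have := win K KK Kn.
      by rewrite pn0 (@le0_lneNy _ 0%:E) // addNye ltNge leNye.
    move=> j /= /andP[jK /eqP jn].
    by rewrite -lt_lneD; [exact: win|exact: p_ge0|rewrite lt_def pn0 p_ge0].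
  case: eqP => // /eqP pn0 win; apply/argmax_eq_set1 => // j jK /eqP jn.
  rewrite lt_lneD; [|exact: p_ge0|by rewrite lt_def pn0 p_ge0].
  by apply: win; rewrite /= jK.
have [->|/eqP pn0] := eqVneq (p n) 0; first by rewrite measure0 mul0e.
have pn_gt0 : 0 < p n by rewrite lt_def p_ge0 // andbT; apply/eqP.
rewrite probability_fineE; last exact: measurable_race_win.
rewrite (race_win_probability p0 p_ge0 p_nd g_law g_indep nK pn_gt0) EFinM.
congr (_ * _)%E; rewrite -sumEFin; apply: eq_big_nat => i /andP[i1 iN].
have iK : (1 <= i <= K)%N by rewrite i1 (leq_trans _ (proj2 (andP nK))).
by rewrite beta_coefE // S_gt0.
Qed.
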